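(* Consider the Bayesian model with exponential prior on the error variance described in the context, with $L$ nondecreasing and $0<L(u)\le M<\infty$. For any $0<u<1$ there is a constant $C>0$, not depending on $\tau$ or $X_i$, such that for all $0<\tau<1$ and every value of $X_i\neq0$, $$\mathbb{E}\big[\kappa_i I_{[\kappa_i\le u]}\mid X_i\big]\le \frac{C}{X_i^2}.$$
   Context: Model (for given $\tau>0$): (i) $X_i\mid\theta_i,\sigma_i^2\sim N(\theta_i,\sigma_i^2)$ independently, $i=1,\dots,n$; (ii) $\theta_i\mid\sigma_i^2,\lambda_i^2,\tau^2\sim N(0,\sigma_i^2\lambda_i^2\tau^2)$ independently; (iii) $\lambda_1^2,\dots,\lambda_n^2,\sigma_1^2,\dots,\sigma_n^2$ are mutually independent, each $\lambda_i^2$ having the proper prior density $\Pi(\lambda_i^2)=K(\lambda_i^2)^{-a-1}L(\lambda_i^2)$ on $(0,\infty)$, with $a>0$, $K>0$ the normalizing constant, and $L$ a slowly varying function (at infinity); (iv) each $\sigma_i^2$ has prior density $\Pi(\sigma_i^2)=\tfrac12\exp(-\sigma_i^2/2)$ on $(0,\infty)$. Standing assumption on $L$: it is nondecreasing and $0<L(u)\le M<\infty$ for all $u>0$. The shrinkage factor is $\kappa_i=(1+\lambda_i^2\tau^2)^{-1}$, and $\mathbb{E}(\cdot\mid X_i)$ denotes posterior expectation given $X_i$ under this model. *)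

(* Defs.v *)
From HB Require Import structures.
From mathcomp Require Import all_boot all_order all_algebra.
From mathcomp Require Import all_classical all_reals all_analysis.
Set Implicit Arguments.
Unset Strict Implicit.
Unset Printing Implicit Defensive.
Import Order.TTheory GRing.Theory Num.Theory.
Import numFieldNormedType.Exports.
Local Open Scope classical_set_scope.
Local Open Scope ring_scope.

Definition slowly_varying (R : realType) (L : R -> R) : Prop :=
  forall c : R, 0 < c -> L (c * t) / L t @[t --> +oo] --> (1 : R).

(* The model for one coordinate: since the coordinates are mutually independent,
   conditioning on X_i alone only involves (theta_i, sigma_i^2, lambda_i^2).
   Throughout, [s] is sigma_i^2 and [l] is lambda_i^2; both are variances. *)

Definition lambda2_prior (R : realType) (K a : R) (L : R -> R) (l : R) : R :=
  K * l `^ (- a - 1) * L l.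

(* [exponential_pdf 2^-1 s] is 1/2 exp(-s/2) for s >= 0. *)
Definition sigma2_prior (R : realType) (s : R) : R := exponential_pdf 2^-1 s.

(* The second argument of [normal_pdf] is the standard deviation. *)
Definition joint_density (R : realType) (K a : R) (L : R -> R)
    (tau x theta s l : R) : R :=
  normal_pdf theta (Num.sqrt s) x *
  normal_pdf 0 (Num.sqrt (s * l * tau ^+ 2)) theta *
  sigma2_prior s * lambda2_prior K a L l.

Definition joint_integral (R : realType) (K a : R) (L : R -> R) (tau x : R)
    (f : R -> R -> R -> R) : \bar R :=
  (\int[lebesgue_measure]_(l in `]0%R, +oo[)
   \int[lebesgue_measure]_(s in `]0%R, +oo[)
   \int[lebesgue_measure]_(theta in [set: R])
     (f theta s l * joint_density K a L tau x theta s l)%:E)%E.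

(* E[f(theta_i, sigma_i^2, lambda_i^2) | X_i = x] by Bayes' formula; the
   denominator is the marginal density of X_i at x. *)
Definition posterior_expectation (R : realType) (K a : R) (L : R -> R)
    (tau x : R) (f : R -> R -> R -> R) : \bar R :=
  (joint_integral K a L tau x f
   / joint_integral K a L tau x (fun _ _ _ => 1%R))%E.

Definition shrinkage (R : realType) (tau l : R) : R := (1 + l * tau ^+ 2)^-1.

(* Main.v *)
Require Import Defs.
From HB Require Import structures.
From mathcomp Require Import all_boot all_order all_algebra.
From mathcomp Require Import all_classical all_reals all_analysis.
From mathcomp Require Import measurable_realfun ring lra.
Set Implicit Arguments.
Unset Strict Implicit.
Unset Printing Implicit Defensive.
Import Order.TTheory GRing.Theory Num.Theory.
Import numFieldNormedType.Exports.
Local Open Scope classical_set_scope.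
Local Open Scope ring_scope.

(** Integrating out theta turns the likelihood into N(0, sigma^2 w) with
    w = 1 / kappa = 1 + lambda^2 tau^2, and integrating out sigma^2 leaves a
    function G(w) of lambda^2 alone. From e^(-z) z^k <= C one gets
    G(w) <= C w^n / |x|^(2n+1) for every n, while G(w) >= c / |x| as long as w is
    comparable to x^2. Put B = x^2 / tau^2. Where lambda^2 > B, or everywhere if
    x^2 <= 1, kappa is at most 1 / x^2 and there is nothing to do. On
    lambda^2 <= B and kappa <= u we have w <= lambda^2 tau^2 / (1 - u), and a large
    n makes lambda^(2(n-1)) times the prior power of lambda^2 increasing, so that
    this part of the numerator is O(B B^(-a-1) / |x|^3). The interval [B, 2B] alone
    contributes at least c B B^(-a-1) / |x| to the denominator. *)

(** * Normal densities as functions of the variance *)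

Lemma normal_pdf_sqrtE (R : realType) (m v x : R) : 0 < v ->
  normal_pdf m (Num.sqrt v) x =
  (Num.sqrt (v * pi *+ 2))^-1 * expR (- (x - m) ^+ 2 / (v *+ 2)).
Proof.
move=> v0; rewrite normal_pdfE; last by rewrite gt_eqF// sqrtr_gt0.
by rewrite /normal_peak /normal_fun sqr_sqrtr// ltW.
Qed.

(** Completing the square in [theta]: likelihood times prior is the marginal density of [x] times
    the posterior density of [theta]. In this form [theta] occurs in one normal density only, which
    integrates to 1. *)
Lemma normal_pdf_convolution (R : realType) (s t x theta : R) :
  0 < s -> 0 < t ->
  normal_pdf theta (Num.sqrt s) x * normal_pdf 0 (Num.sqrt t) theta =
  normal_pdf 0 (Num.sqrt (s + t)) x *
  normal_pdf (x * t / (s + t)) (Num.sqrt (s * t / (s + t))) theta.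
Proof.
move=> s0 t0; have st0 : 0 < s + t by exact: addr_gt0.
have v0 : 0 < s * t / (s + t) by rewrite divr_gt0// mulr_gt0.
have pi0 := pi_gt0 R.
rewrite !normal_pdf_sqrtE// mulrACA [RHS]mulrACA -!expRD.
have p0 (v : R) : 0 < v -> 0 <= v * pi *+ 2.
  by move=> ?; rewrite mulrn_wge0// mulr_ge0 ?ltW.
congr (_ * expR _).
  rewrite -!invfM -!sqrtrM ?p0//; congr (Num.sqrt _)^-1.
  by field; rewrite gt_eqF.
by field; rewrite !gt_eqF.
Qed.

Lemma measurable_normal_pdf_sqrt (R : realType) (m x : R) :
  measurable_fun [set: R] (fun v => normal_pdf m (Num.sqrt v) x).
Proof.
(* For [v <= 0] the square root is 0 and [normal_pdf] takes its degenerate value, the indicator of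
   [[0, 1]]. For [v > 0], real powers, measurable on the whole line, replace the root and the
   inverses. *)
rewrite (_ : (fun _ => _) = fun v => if 0 < v then
  (v * pi *+ 2) `^ (- 2^-1) * expR (- ((x - m) ^+ 2 / 2) * v `^ (-1))
  else \1_`[0, 1] x); last first.
  apply/funext => v; case: ifPn => [v0|]; last first.
    by rewrite -leNgt => v0; rewrite ler0_sqrtr// /normal_pdf eqxx.
  rewrite normal_pdf_sqrtE// powRN powR12_sqrt ?powR_inv1 ?(ltW v0)//.
    by congr (_ * expR _); field; rewrite gt_eqF.
  by rewrite mulrn_wge0// mulr_ge0 ?pi_ge0// ltW.
apply: measurable_fun_ifT => //=; first exact: measurable_fun_ltr.
apply: measurable_funM => /=.
  apply: (measurableT_comp (@measurable_powR R _)) => /=.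
  by under eq_fun do rewrite -mulrnAr; exact: measurable_funM.
apply: (measurableT_comp (@measurable_expR R)) => /=.
by apply: measurable_funM => //; exact: measurable_powR.
Qed.

(** One term of the exponential series: [z^n / n! <= e^z]. *)
Lemma exprn_expRN_le (R : realType) (z : R) (n : nat) : 0 <= z ->
  z ^+ n * expR (- z) <= n`!%:R.
Proof.
move=> z0; rewrite expRN ler_pdivrMr ?expR_gt0//.
case: n => [|n]; first by rewrite expr0 fact0 mul1r (le_trans _ (expR_ge1Dx z))// lerDl.
rewrite mulrC -ler_pdivrMr ?ltr0n ?fact_gt0//.
by rewrite (le_trans _ (expR_ge1Dxn n z0))// lerDr.
Qed.

(** With [z = x^2 / (2 v)] the density is at most [sqrt z e^(-z) / |x|], and [v^n] equals
    [|x|^(2n) / (2 z)^n]. What remains is that [z^n sqrt z e^(-z)] is bounded. *)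
Lemma normal_pdf_sqrt_le (R : realType) (n : nat) :
  exists2 C : R, 0 < C & forall x v : R, x != 0 -> 0 < v ->
    normal_pdf 0 (Num.sqrt v) x <= C * v ^+ n / `|x| ^+ n.*2.+1.
Proof.
exists (2 ^+ n * (n`!%:R + n.+1`!%:R)).
  by rewrite mulr_gt0 ?exprn_gt0// addr_gt0// ltr0n fact_gt0.
move=> x v x0 v0; rewrite normal_pdf_sqrtE// subr0.
set z := x ^+ 2 / (v *+ 2).
have z0 : 0 < z by rewrite divr_gt0 ?mulrn_wgt0// exprn_even_gt0.
have pi1 : 1 <= pi :> R by rewrite (le_trans _ (pi_ge2 R))// ler1n.
have nx0 : 0 < `|x| by rewrite normr_gt0.
have s0 : 0 < Num.sqrt z by rewrite sqrtr_gt0.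
have sE : Num.sqrt (v *+ 2) = `|x| / Num.sqrt z.
  rewrite -sqrtr_sqr -sqrtrV ?(ltW z0)// -sqrtrM ?sqr_ge0//; congr Num.sqrt.
  rewrite /z; field; rewrite ?x0 ?gt_eqF//.
have -> : - x ^+ 2 / (v *+ 2) = - z by rewrite mulNr.
have vE : v ^+ n = `|x| ^+ n.*2 / (2 ^+ n * z ^+ n).
  rewrite -exprMn -mul2n exprM real_normK ?num_real// -expr_div_n.
  by congr (_ ^+ n); rewrite /z; field; rewrite ?x0 ?gt_eqF.
have h1 : (Num.sqrt (v * pi *+ 2))^-1 <= Num.sqrt z / `|x|.
  rewrite -[leRHS]invrK invf_div -sE lef_pV2 ?posrE ?sqrtr_gt0 ?mulrn_wgt0 ?mulr_gt0 ?pi_gt0//.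
  by rewrite ler_wsqrtr// lerMn2r/= ler_peMr// ltW.
apply: (le_trans (ler_wpM2r (expR_ge0 _) h1)).
rewrite vE exprS.
have -> : 2 ^+ n * (n`!%:R + n.+1`!%:R) * (`|x| ^+ n.*2 / (2 ^+ n * z ^+ n)) /
    (`|x| * `|x| ^+ n.*2) = (n`!%:R + n.+1`!%:R) / z ^+ n / `|x|.
  have : `|x| ^+ n.*2 != 0 by rewrite expf_neq0// normr_eq0.
  have : z ^+ n != 0 by rewrite expf_neq0// gt_eqF.
  have : 2 ^+ n != 0 :> R by rewrite expf_neq0// pnatr_eq0.
  move: (2 ^+ n) (z ^+ n) (`|x| ^+ n.*2) (_ + _) => p q r f p0 q0 r0.
  by field; rewrite p0 q0 r0 gt_eqF.
rewrite mulrAC ler_pM2r ?invr_gt0// ler_pdivlMr ?exprn_gt0//.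
(* Trades the half-integer power for the exponents [n] and [n.+1]; hence the sum of two factorials
   in the constant. *)
have sz : Num.sqrt z <= 1 + z.
  have := sqr_ge0 (Num.sqrt z - 1); rewrite sqrrB1 sqr_sqrtr ?(ltW z0)//.
  by have := ltW s0; lra.
rewrite -mulrA [expR _ * _]mulrC.
apply: (@le_trans _ _ ((1 + z) * (z ^+ n * expR (- z)))).
  by rewrite ler_pM2r ?mulr_gt0 ?exprn_gt0 ?expR_gt0.
by rewrite mulrDl mul1r mulrA -exprS lerD// exprn_expRN_le// ltW.
Qed.

(** In this range of [v] the exponent [x^2 / (2 v)] is at most 1, and the peak is no lower than that
    for the variance [c x^2], which is of order [1 / |x|]. *)
Lemma normal_pdf_sqrt_ge (R : realType) (c : R) : 0 < c ->
  exists2 C : R, 0 < C & forall x v : R, x != 0 -> x ^+ 2 <= v <= c * x ^+ 2 ->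
    C / `|x| <= normal_pdf 0 (Num.sqrt v) x.
Proof.
move=> c0; exists ((Num.sqrt (c * pi *+ 2))^-1 * expR (- 1)).
  by rewrite mulr_gt0 ?expR_gt0// invr_gt0 sqrtr_gt0 mulrn_wgt0// mulr_gt0// pi_gt0.
move=> x v x0 /andP[xv vx].
have x20 : 0 < x ^+ 2 by rewrite exprn_even_gt0.
have v0 : 0 < v by exact: lt_le_trans xv.
have p0 := pi_gt0 R.
have cp0 : 0 < c * pi *+ 2 by rewrite mulrn_wgt0// mulr_gt0.
have vp0 : 0 < v * pi *+ 2 by rewrite mulrn_wgt0// mulr_gt0.
rewrite normal_pdf_sqrtE// subr0 mulrAC ler_pM ?expR_ge0 ?mulr_ge0 ?invr_ge0//.
  rewrite -sqrtr_sqr -invfM -sqrtrM ?(ltW cp0)//.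
  rewrite lef_pV2 ?posrE ?sqrtr_gt0 ?(mulr_gt0 cp0)// ler_wsqrtr//.
  by have := ler_wpM2r (ltW p0) vx; lra.
rewrite ler_expR mulNr lerN2 ler_pdivrMr ?mulrn_wgt0// mul1r.
by rewrite (le_trans xv)// mulr2n lerDl ltW.
Qed.

(** * Integrating out the mean and the error variance *)

(* The density of [x] given lambda^2, where [w] stands for [1 + lambda^2 tau^2]. *)
Definition scale_mixture (R : realType) (x w : R) : \bar R :=
  (\int[lebesgue_measure]_(s in `]0%R, +oo[)
     (normal_pdf 0 (Num.sqrt (s * w)) x * sigma2_prior s)%:E)%E.

Lemma sigma2_prior_ge0 (R : realType) (s : R) : 0 <= sigma2_prior s.
Proof. by apply: exponential_pdf_ge0; rewrite invr_ge0. Qed.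

Lemma measurable_mixture_integrand (R : realType) (x w : R) (D : set R) :
  measurable_fun D (fun s : R =>
    (normal_pdf 0 (Num.sqrt (s * w)) x * sigma2_prior s)%:E).
Proof.
apply: measurable_funTS; apply/measurable_EFinP; apply: measurable_funM.
  apply: (measurableT_comp (measurable_normal_pdf_sqrt 0 x)) => /=.
  exact: measurable_funM.
exact: measurable_exponential_pdf.
Qed.

Lemma mixture_integrand_ge0 (R : realType) (x w s : R) :
  (0 <= (normal_pdf 0 (Num.sqrt (s * w)) x * sigma2_prior s)%:E)%E.
Proof. by rewrite lee_fin mulr_ge0 ?normal_pdf_ge0 ?sigma2_prior_ge0. Qed.

Lemma scale_mixture_ge0 (R : realType) (x w : R) : (0 <= scale_mixture x w)%E.
Proof. by apply: integral_ge0 => s _; exact: mixture_integrand_ge0. Qed.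

Lemma measurable_scale_mixture (R : realType) (x : R) :
  measurable_fun [set: R] (scale_mixture x).
Proof.
(* The indicator turns the half-line into the whole line, so that Tonelli's theorem gives
   measurability in the outer variable. *)
pose f (p : R * R) : \bar R :=
  (\1_`]0, +oo[ p.2 *
    (normal_pdf 0 (Num.sqrt (p.2 * p.1)) x * sigma2_prior p.2))%:E.
rewrite (_ : scale_mixture x = fubini_F lebesgue_measure f).
  apply: measurable_fun_fubini_tonelli_F.
    apply/measurable_EFinP; apply: measurable_funM.
      by apply: measurableT_comp.
    apply: measurable_funM.
      apply: (measurableT_comp (measurable_normal_pdf_sqrt 0 x)) => /=.
      exact: measurable_funM.
    apply: measurableT_comp => //.
    exact: measurable_exponential_pdf.
  move=> p; rewrite lee_fin mulr_ge0//.
  by rewrite mulr_ge0 ?normal_pdf_ge0 ?sigma2_prior_ge0.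
apply/funext => w; rewrite /scale_mixture /fubini_F [LHS]integral_mkcond.
apply: eq_integral => s _; rewrite /f /= patchE indicE.
by case: ifPn => _; rewrite ?mul1r ?mul0r.
Qed.

(** For a function of lambda^2 alone, the convolution identity integrates [theta] out. Both the
    numerator and the marginal density of [x] are of this type. *)
Lemma joint_integral_mixture (R : realType) (K a : R) (L : R -> R)
    (tau x : R) (f : R -> R) : 0 < tau ->
  (forall l, 0 < l -> 0 <= f l * lambda2_prior K a L l) ->
  joint_integral K a L tau x (fun _ _ l => f l) =
  (\int[lebesgue_measure]_(l in `]0%R, +oo[)
     ((f l * lambda2_prior K a L l)%:E * scale_mixture x (1 + l * tau ^+ 2)))%E.
Proof.
move=> tau0 fL0; apply: eq_integral => l; rewrite inE/= in_itv/= andbT => l0.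
rewrite -ge0_integralZl_EFin//; last 3 first.
- by move=> s _; exact: mixture_integrand_ge0.
- exact: measurable_mixture_integrand.
- exact: fL0.
apply: eq_integral => s; rewrite inE/= in_itv/= andbT => s0.
have t0 : 0 < s * l * tau ^+ 2 by rewrite !mulr_gt0// exprn_gt0.
set c := (f l * lambda2_prior K a L l)%R.
set v := s + s * l * tau ^+ 2.
under eq_integral => theta _.
  have -> : f l * joint_density K a L tau x theta s l =
    (c * (normal_pdf 0 (Num.sqrt (s * (1 + l * tau ^+ 2))) x * sigma2_prior s)) *
    normal_pdf (x * (s * l * tau ^+ 2) / v)
      (Num.sqrt (s * (s * l * tau ^+ 2) / v)) theta.
    have -> : s * (1 + l * tau ^+ 2) = v by rewrite /v; ring.
    rewrite /joint_density normal_pdf_convolution// /c -/v.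
    by ring.
  rewrite EFinM; over.
rewrite integralZl//; last exact: integrable_normal_pdf.
by rewrite integral_normal_pdf mule1.
Qed.

(** * Upper and lower bounds for the scale mixture *)

(** The Gaussian bound contributes [s^n]. Writing [e^(-s/2)] as the square of [e^(-s/4)], one factor
    absorbs [s^n] at the cost [4^n n!]; the other is, up to a constant, an exponential density of
    rate 1/4, with integral at most 1. *)
Lemma scale_mixture_le (R : realType) (n : nat) :
  exists2 C : R, 0 < C & forall x w : R, x != 0 -> 0 < w ->
    (scale_mixture x w <= (C * w ^+ n / `|x| ^+ n.*2.+1)%:E)%E.
Proof.
have [C C0 CP] := normal_pdf_sqrt_le R n.
(* The final 2 is the ratio of the normalizing constants 1/2 and 1/4 of the two exponential
   densities. *)
exists (C * (4 ^+ n * n`!%:R * 2)).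
  by rewrite !mulr_gt0// ?exprn_gt0// ltr0n fact_gt0.
move=> x w x0 w0; set D := _ / _.
have nx0 : 0 < `|x| ^+ n.*2.+1 by rewrite exprn_gt0// normr_gt0.
have D0 : 0 <= D.
  by rewrite divr_ge0 ?(ltW nx0)// !mulr_ge0 ?exprn_ge0 ?(ltW C0) ?(ltW w0).
have mexp : measurable_fun [set: R] (fun s => (exponential_pdf 4^-1 s)%:E).
  by apply/measurable_EFinP; exact: measurable_exponential_pdf.
have e0 (s : R) : (0 <= (exponential_pdf 4^-1 s)%:E)%E.
  by rewrite lee_fin exponential_pdf_ge0.
apply: (@le_trans _ _ (\int[lebesgue_measure]_(s in `]0%R, +oo[)
    (D%:E * (exponential_pdf 4^-1 s)%:E))%E).
  apply: ge0_le_integral => //=.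
  - by move=> s _; exact: mixture_integrand_ge0.
  - exact: measurable_mixture_integrand.
  - by apply: measurable_funeM; exact: measurable_funTS.
  move=> s; rewrite in_itv/= andbT => s0.
  rewrite lee_fin (le_trans (ler_wpM2r (sigma2_prior_ge0 s) (CP _ _ x0 (mulr_gt0 s0 w0))))//.
  rewrite /sigma2_prior !exponential_pdfE ?(ltW s0)//.
  have -> : - 2^-1 * s = - (s / 4) + - 4^-1 * s by field.
  rewrite expRD.
  have s40 : 0 <= s / 4 by rewrite divr_ge0// ltW.
  have h := exprn_expRN_le n s40.
  rewrite expr_div_n in h.
  have n4 : 0 < 4 ^+ n :> R by rewrite exprn_gt0.
  have wn0 : 0 < w ^+ n by rewrite exprn_gt0.
  rewrite /D exprMn.
  set E := expR (- 4^-1 * s).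
  have E0 : 0 < E by exact: expR_gt0.
  have -> : C * (s ^+ n * w ^+ n) / `|x| ^+ n.*2.+1 * (2^-1 * (expR (- (s / 4)) * E))
    = (s ^+ n / 4 ^+ n * expR (- (s / 4))) *
      (C * w ^+ n * 4 ^+ n / `|x| ^+ n.*2.+1 * 2^-1 * E).
    by field; rewrite !gt_eqF.
  apply: (le_trans (ler_wpM2r _ h)).
    by rewrite !mulr_ge0 ?invr_ge0// ltW.
  rewrite le_eqVlt; apply/orP; left; apply/eqP; move: (n`!%:R) => F.
  by field; rewrite !gt_eqF.
rewrite ge0_integralZl_EFin//; last exact: measurable_funTS.
rewrite -[leRHS]mule1 lee_wpmul2l//.
by rewrite -(@integral_exponential_pdf R 4^-1)// ge0_subset_integral.
Qed.

(** Only [s] in [[1, 2]] is kept: there [s w] lies between [x^2] and [2 c x^2], and the exponential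
    prior is at least [e^(-1) / 2]. *)
Lemma scale_mixture_ge (R : realType) (c : R) : 0 < c ->
  exists2 C : R, 0 < C & forall x w : R, x != 0 -> x ^+ 2 <= w <= c * x ^+ 2 ->
    ((C / `|x|)%:E <= scale_mixture x w)%E.
Proof.
move=> c0; have c20 : 0 < 2 * c by rewrite mulr_gt0.
have [C C0 CP] := normal_pdf_sqrt_ge c20.
exists (C * (2^-1 * expR (- 1))); first by rewrite !mulr_gt0 ?expR_gt0.
move=> x w x0 /andP[xw wx].
have w0 : 0 <= w by rewrite (le_trans _ xw)// sqr_ge0.
have nx0 : 0 < `|x| by rewrite normr_gt0.
have sub : `[1%R, 2%R] `<=` (`]0%R, +oo[ : set R).
  by move=> s /=; rewrite !in_itv/= andbT => /andP[+ _]; apply: lt_le_trans.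
apply: (@le_trans _ _ (\int[lebesgue_measure]_(s in `[1%R, 2%R])
    (normal_pdf 0 (Num.sqrt (s * w)) x * sigma2_prior s)%:E)%E); last first.
  apply: ge0_subset_integral => //; first exact: measurable_mixture_integrand.
  by move=> s _; exact: mixture_integrand_ge0.
apply: (@le_trans _ _ (\int[lebesgue_measure]_(s in `[1%R, 2%R])
    cst (C * (2^-1 * expR (- 1)) / `|x|)%:E s)%E).
  rewrite integral_cst//= lebesgue_measure_itv/= lte_fin ltr1n/=.
  by rewrite -EFinB -EFinM lee_fin (_ : 2 - 1 = 1) ?mulr1//; ring.
apply: ge0_le_integral => //=.
- by move=> s _; rewrite lee_fin !mulr_ge0 ?invr_ge0 ?expR_ge0// ltW.
- exact: measurable_mixture_integrand.
move=> s; rewrite in_itv/= => /andP[s1 s2].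
have s0 : 0 <= s by lra.
rewrite lee_fin /sigma2_prior exponential_pdfE// mulrAC.
apply: ler_pM.
- by rewrite divr_ge0// ltW.
- by rewrite mulr_ge0 ?expR_ge0.
- apply: CP => //; apply/andP; split.
    by rewrite (le_trans xw)// ler_peMl.
  by rewrite (le_trans (ler_pM s0 w0 s2 wx))// mulrA.
- by rewrite ler_pM2l// ler_expR; lra.
Qed.

(** * Sign and measurability of the prior on lambda^2 and of the shrinkage factor *)

Lemma lambda2_prior_ge0 (R : realType) (K a : R) (L : R -> R) (l : R) :
  0 <= K -> 0 <= L l -> 0 <= lambda2_prior K a L l.
Proof. by move=> K0 L0; rewrite !mulr_ge0 ?powR_ge0. Qed.

Lemma measurable_lambda2_prior (R : realType) (K a : R) (L : R -> R) :
  (forall v w : R, 0 < v -> v <= w -> L v <= L w) ->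
  (forall v : R, 0 < v -> 0 < L v) ->
  measurable_fun (`]0, +oo[ : set R) (lambda2_prior K a L).
Proof.
move=> L_nd L_gt0.
(* The values of [L] at [v <= 0] are arbitrary; replacing them by 0 gives a function nondecreasing
   on the whole line, hence measurable. *)
pose L' v := if 0 < v then L v else 0.
have mL' : measurable_fun (`]0, +oo[ : set R) L'.
  apply: nondecreasing_measurable => // v w vw; rewrite /L'.
  have [v0|v0] := ltP 0 v; first by rewrite (lt_le_trans v0 vw) L_nd.
  by case: ifP => // w0; exact/ltW/L_gt0.
apply: measurable_funM.
  by apply: measurable_funM => //; apply: measurable_funTS; exact: measurable_powR.
apply: eq_measurable_fun mL' => v; rewrite inE/= in_itv/= andbT /L' => v0.
by rewrite v0.
Qed.

Lemma shrinkage_gt0 (R : realType) (tau l : R) : 0 < l -> 0 < shrinkage tau l.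
Proof.
by move=> l0; rewrite invr_gt0 ltr_pwDl// mulr_ge0 ?sqr_ge0// ltW.
Qed.

Lemma measurable_shrinkage (R : realType) (tau : R) :
  measurable_fun (`]0, +oo[ : set R) (shrinkage tau).
Proof.
apply: (eq_measurable_fun (fun l : R => (1 + l * tau ^+ 2) `^ (-1))).
  move=> l; rewrite inE/= in_itv/= andbT => l0.
  by rewrite powR_inv1// addr_ge0// mulr_ge0 ?sqr_ge0// ltW.
apply: measurable_funTS.
apply: (measurableT_comp (@measurable_powR R _)) => /=.
by apply: measurable_funD => //; exact: measurable_funM.
Qed.

(** * Bounds for the numerator's integrand and for the marginal density *)

(** The total exponent of [l] is [m - a], which is nonnegative, so the power is nondecreasing. *)
Lemma exprn_powR_le (R : realType) (m : nat) (a l B : R) :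
  a <= m%:R -> 0 < l -> l <= B ->
  l ^+ m.+1 * l `^ (- a - 1) <= B ^+ m.+1 * B `^ (- a - 1).
Proof.
move=> am l0 lB; have B0 : 0 < B by exact: lt_le_trans lB.
have E (y : R) : 0 < y -> y ^+ m.+1 * y `^ (- a - 1) = y `^ (m%:R - a).
  move=> y0; rewrite -powR_mulrn ?(ltW y0)// -powRD; last first.
    by rewrite (gt_eqF y0) implybT.
  by congr (_ `^ _); rewrite -natr1; ring.
by rewrite !E// ge0_ler_powR ?subr_ge0// nnegrE ltW.
Qed.

(** The factor [1 / w] lowers [w^(m+2)] to [w^(m+1)], which is at most a multiple of
    [(l tau^2)^(m+1)]. Times the prior power this is largest at [l = B], where
    [(B tau^2)^(m+1) = x^(2(m+1))] cancels all but [|x|^3] of the denominator. The resulting bound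
    is free of [l]. *)
Lemma shrunk_integrand_le (R : realType) (K a M u : R) (L : R -> R) :
  0 < a -> 0 < K -> (forall v : R, 0 < v -> 0 < L v <= M) -> u < 1 ->
  exists2 c : R, 0 < c & forall tau x l : R, 0 < tau -> x != 0 -> 0 < l ->
    l <= x ^+ 2 / tau ^+ 2 -> shrinkage tau l <= u ->
    ((shrinkage tau l * lambda2_prior K a L l)%:E *
       scale_mixture x (1 + l * tau ^+ 2) <=
     (c * (x ^+ 2 / tau ^+ 2) `^ (- a - 1) / `|x| ^+ 3)%:E)%E.
Proof.
move=> a0 K0 L_bnd u1.
have M0 : 0 < M by have /andP[] := L_bnd 1 ltr01; exact: lt_le_trans.
pose m := Num.bound a.
have am : a <= m%:R by apply/ltW; rewrite archi_boundP// ltW.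
have [C C0 CP] := scale_mixture_le R m.+2.
have u1' : 0 < 1 - u by rewrite subr_gt0.
exists (K * M * C / (1 - u) ^+ m.+1).
  by rewrite divr_gt0 ?exprn_gt0// !mulr_gt0.
move=> tau x l tau0 x0 l0 lB ku.
set B := x ^+ 2 / tau ^+ 2 in lB *.
have [L0 LM] := andP (L_bnd l l0).
set w := 1 + l * tau ^+ 2.
have q0 : 0 < l * tau ^+ 2 by rewrite mulr_gt0 ?exprn_gt0.
have w0 : 0 < w by rewrite addr_gt0.
have nx0 : 0 < `|x| by rewrite normr_gt0.
have kE : shrinkage tau l = w^-1 by [].
(* [w^-1 <= u] says that the [1] in [w = 1 + l tau^2] is at most [u w]. *)
have wq : w <= l * tau ^+ 2 / (1 - u).
  have : 1 <= u * w by rewrite -ler_pdivrMr// mul1r -kE.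
  by rewrite ler_pdivlMr// /w; lra.
have pi0 : 0 <= shrinkage tau l * lambda2_prior K a L l.
  by rewrite mulr_ge0 ?invr_ge0 ?(ltW w0)// lambda2_prior_ge0// ltW.
apply: (@le_trans _ _ ((shrinkage tau l * lambda2_prior K a L l)%:E *
    (C * w ^+ m.+2 / `|x| ^+ m.+2.*2.+1)%:E)%E).
  by apply: lee_wpmul2l; [rewrite lee_fin|exact: CP].
rewrite -EFinM lee_fin kE.
have wm : w ^+ m.+1 <= (l * tau ^+ 2 / (1 - u)) ^+ m.+1.
  by rewrite lerXn2r// nnegrE ltW// divr_gt0.
have lm := exprn_powR_le am l0 lB.
have p0 : 0 <= l `^ (- a - 1) by exact: powR_ge0.
have xE : `|x| ^+ m.+2.*2.+1 = (x ^+ 2) ^+ m.+1 * `|x| ^+ 3.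
  by rewrite -real_normK ?num_real// -exprM -exprD; congr (_ ^+ _); rewrite mul2n doubleS addnC.
have x2m : 0 < (x ^+ 2) ^+ m.+1 by rewrite exprn_gt0// exprn_even_gt0.
have t2m : 0 < (tau ^+ 2) ^+ m.+1 by rewrite !exprn_gt0.
have u1m : 0 < (1 - u) ^+ m.+1 by rewrite exprn_gt0.
have BE : B ^+ m.+1 = (x ^+ 2) ^+ m.+1 / (tau ^+ 2) ^+ m.+1.
  by rewrite /B expr_div_n.
have x3 : 0 < `|x| ^+ 3 by rewrite exprn_gt0.
rewrite expr_div_n exprMn in wm.
rewrite BE in lm.
rewrite xE /lambda2_prior (exprS w).
set P := B `^ _ in lm *; set p := l `^ _ in lm p0 *.
set X := (x ^+ 2) ^+ m.+1 in lm x2m *.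
set T := (tau ^+ 2) ^+ m.+1 in lm t2m wm *.
set U := (1 - u) ^+ m.+1 in u1m wm *.
set W := w ^+ m.+1 in wm *.
set Y := l ^+ m.+1 in wm lm.
(* Regrouped for a factorwise comparison: [L l] against [M], then the powers of [w] and [l], then a
   common constant. *)
have -> : w^-1 * (K * p * L l) * (C * (w * W) / (X * `|x| ^+ 3)) =
   L l * (W * p) * (K * C / X / `|x| ^+ 3) by field; rewrite !gt_eqF.
have -> : K * M * C / U * P / `|x| ^+ 3 =
   M * (T / U * (X / T * P)) * (K * C / X / `|x| ^+ 3) by field; rewrite !gt_eqF.
apply: ler_wpM2r; first by apply/ltW; rewrite !divr_gt0// mulr_gt0.
apply: ler_pM => //; first exact: ltW.
  by rewrite mulr_ge0// /W exprn_ge0// ltW.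
apply: (@le_trans _ _ (T / U * (Y * p))); last first.
  by rewrite ler_wpM2l// divr_ge0// ltW.
rewrite [leRHS]mulrA; apply: ler_wpM2r => //.
by apply: (le_trans wm); rewrite [leRHS]mulrC [leRHS]mulrA.
Qed.

(** The integral is restricted to [[B, 2B]], of length [B]. There the prior power is at least its
    value at [2B], and [1 + l tau^2] is comparable to [x^2], so [scale_mixture_ge] applies. *)
Lemma marginal_ge (R : realType) (K a : R) (L : R -> R) :
  0 < K -> (forall v w : R, 0 < v -> v <= w -> L v <= L w) ->
  (forall v : R, 0 < v -> 0 < L v) -> 0 < a ->
  exists2 c : R, 0 < c & forall tau x : R, 0 < tau < 1 -> 1 < x ^+ 2 ->
    ((c * (x ^+ 2 / tau ^+ 2 * (x ^+ 2 / tau ^+ 2) `^ (- a - 1)) / `|x|)%:E <=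
     \int[lebesgue_measure]_(l in `]0%R, +oo[)
       ((lambda2_prior K a L l)%:E * scale_mixture x (1 + (l * tau ^+ 2)%R)))%E.
Proof.
move=> K0 L_nd L_gt0 a0.
(* The 3 comes from [1 + l tau^2 <= 1 + 2 x^2 <= 3 x^2], valid for [l <= 2B] and [x^2 > 1]. *)
have [C C0 CP] := @scale_mixture_ge R 3 (ltr0Sn _ _).
have L1 := L_gt0 1 ltr01.
exists (K * 2 `^ (- a - 1) * L 1 * C); first by rewrite !mulr_gt0 ?powR_gt0.
move=> tau x /andP[tau0 tau1] x1.
set B := x ^+ 2 / tau ^+ 2.
have t20 : 0 < tau ^+ 2 by rewrite exprn_gt0.
have x0 : x != 0 by apply: contraTneq x1 => ->; rewrite expr0n/= ltr10.
have nx0 : 0 < `|x| by rewrite normr_gt0.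
(* Here [tau < 1] enters: [B >= 1] makes [L l >= L 1] on the whole interval, a bound free of [tau]
   and [x]. *)
have B1 : 1 <= B.
  rewrite ler_pdivlMr// mul1r (le_trans _ (ltW x1))//.
  by rewrite exprn_ile1// ltW.
have B0 : 0 < B by exact: lt_le_trans B1.
set F := fun l : R => ((lambda2_prior K a L l)%:E * scale_mixture x (1 + (l * tau ^+ 2)%R))%E.
have mF : measurable_fun (`]0, +oo[ : set R) F.
  apply: emeasurable_funM.
    by apply/measurable_EFinP; exact: measurable_lambda2_prior.
  apply: measurable_funTS; apply: (measurableT_comp (measurable_scale_mixture x)).
  by apply: measurable_funD => //; exact: measurable_funM.
have F0 (l : R) : `]0%R, +oo[%classic l -> (0 <= F l)%E.
  rewrite /= in_itv/= andbT => l0; apply: mule_ge0; last exact: scale_mixture_ge0.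
  by rewrite lee_fin lambda2_prior_ge0 ?(ltW K0)//; exact/ltW/L_gt0.
have sub : `[B, B + B] `<=` (`]0%R, +oo[ : set R).
  by move=> l /=; rewrite !in_itv/= andbT => /andP[+ _]; exact: lt_le_trans.
apply: (@le_trans _ _ (\int[lebesgue_measure]_(l in `[B, (B + B)%R]) F l)%E); last first.
  exact: ge0_subset_integral.
set c := K * 2 `^ (- a - 1) * L 1 * C.
have c0 : 0 < c by rewrite !mulr_gt0 ?powR_gt0.
apply: (@le_trans _ _ (\int[lebesgue_measure]_(l in `[B, (B + B)%R])
    cst (c * B `^ (- a - 1) / `|x|)%:E l)%E).
  rewrite integral_cst//= lebesgue_measure_itv/= lte_fin ltrDl B0.
  rewrite -EFinB -EFinM lee_fin addrK.
  by rewrite le_eqVlt; apply/orP; left; apply/eqP; ring.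
apply: ge0_le_integral => //=.
- by move=> l _; rewrite lee_fin divr_ge0 ?mulr_ge0 ?powR_ge0// ltW.
- exact: measurable_funS mF.
move=> l; rewrite in_itv/= => /andP[Bl lB].
have l0 : 0 < l by exact: lt_le_trans Bl.
have BE : B * tau ^+ 2 = x ^+ 2 by rewrite /B divfK// gt_eqF.
have B20 : 0 < 2 * B by exact: mulr_gt0.
have lB2 : l <= 2 * B by rewrite mulr_natl mulr2n.
have lp : 2 `^ (- a - 1) * B `^ (- a - 1) <= l `^ (- a - 1).
  rewrite -powRM ?(ltW B0)// -opprD !powRN.
  rewrite lef_pV2 ?posrE ?powR_gt0// ge0_ler_powR ?nnegrE ?(ltW l0) ?(ltW B20)//.
  by rewrite addr_ge0// ltW.
apply: (@le_trans _ _ ((lambda2_prior K a L l)%:E * (C / `|x|)%:E)%E); last first.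
  apply: lee_wpmul2l.
    by rewrite lee_fin lambda2_prior_ge0 ?(ltW K0)//; exact/ltW/L_gt0.
  have := ler_wpM2r (ltW t20) Bl; have := ler_wpM2r (ltW t20) lB.
  by rewrite mulrDl BE => h1 h2; apply: CP => //; apply/andP; split; lra.
rewrite -EFinM lee_fin /c /lambda2_prior.
rewrite mulrA ler_pM2r ?invr_gt0// mulrAC ler_pM2r//.
rewrite mulrAC; apply: ler_pM.
- by rewrite !mulr_ge0 ?powR_ge0// ltW.
- exact: ltW.
- by rewrite -mulrA ler_pM2l.
- by apply: L_nd => //; exact: le_trans Bl.
Qed.

(** * The posterior expectation as a quotient *)

(** Covers the degenerate denominators of extended-real division: [D = 0] forces [A = 0], and
    [D = +oo] has inverse 0, so the quotient vanishes in both cases. *)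
Lemma lee_div_le (R : realType) (c : R) (A D : \bar R) :
  0 <= c -> (0 <= A -> 0 <= D -> A <= c%:E * D -> A / D <= c%:E)%E.
Proof.
move=> c0 A0; case: D => [d| |] //=.
- rewrite lee_fin le_eqVlt => /predU1P[<-|d0].
    rewrite mule0 => A0'; have -> : A = 0%E by apply/eqP; rewrite eq_le A0 A0'.
    by rewrite mul0e lee_fin.
  by rewrite inver gt_eqF// lee_pdivrMr.
- by move=> _ _; rewrite invey mule0 lee_fin.
Qed.

Theorem lemma4p3 (R : realType) (a K M : R) (L : R -> R)
  (a_gt0 : 0 < a) (K_gt0 : 0 < K)
  (L_sv : slowly_varying L)
  (L_nd : forall v w : R, 0 < v -> v <= w -> L v <= L w)
  (L_bnd : forall v : R, 0 < v -> 0 < L v <= M)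
  (prior_proper :
    (\int[lebesgue_measure]_(l in `]0%R, +oo[) (lambda2_prior K a L l)%:E
      = 1)%E)
  (u : R) (u_01 : 0 < u < 1) :
  exists2 C : R, 0 < C &
    forall tau x : R, 0 < tau < 1 -> x != 0 ->
      (posterior_expectation K a L tau x
         (fun _ _ l =>
            (shrinkage tau l * \1_[set k : R | k <= u] (shrinkage tau l))%R)
       <= (C / x ^+ 2)%:E)%E.
Proof.
have [_ u1] := andP u_01.
have L_gt0 v : 0 < v -> 0 < L v by move=> /L_bnd /andP[].
have [c1 c10 c1P] := shrunk_integrand_le a_gt0 K_gt0 L_bnd u1.
have [c2 c20 c2P] := marginal_ge K_gt0 L_nd L_gt0 a_gt0.
(* The 1 pays for the region where the shrinkage factor is at most [1 / x^2], the ratio [c1 / c2]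
   for the remaining one. *)
exists (1 + c1 / c2); first by rewrite addr_gt0// divr_gt0.
move=> tau x tau01 x0; have [tau0 _] := andP tau01.
have x20 : 0 < x ^+ 2 by rewrite exprn_even_gt0.
have nx0 : 0 < `|x| by rewrite normr_gt0.
have c12 : 0 < c1 / c2 by rewrite divr_gt0.
pose pr := lambda2_prior K a L.
have pr0 l : 0 < l -> 0 <= pr l.
  by move=> l0; rewrite lambda2_prior_ge0 ?(ltW K_gt0)//; exact/ltW/L_gt0.
pose g l := shrinkage tau l * \1_[set k : R | k <= u] (shrinkage tau l).
have g0 l : 0 < l -> 0 <= g l.
  by move=> l0; rewrite mulr_ge0// ltW// shrinkage_gt0.
pose mx l := scale_mixture x (1 + l * tau ^+ 2).
have mx0 l : (0 <= mx l)%E by exact: scale_mixture_ge0.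
have mmx : measurable_fun (`]0, +oo[ : set R) mx.
  apply: measurable_funTS; apply: (measurableT_comp (measurable_scale_mixture x)).
  by apply: measurable_funD => //; exact: measurable_funM.
have mpr : measurable_fun (`]0, +oo[ : set R) pr.
  exact: measurable_lambda2_prior.
have mg : measurable_fun (`]0, +oo[ : set R) g.
  have mk := @measurable_shrinkage R tau.
  apply: measurable_funM => //.
  apply: measurableT_comp => //; apply: measurable_indic.
  by rewrite -set_itvNyc; exact: measurable_itv.
rewrite /posterior_expectation.
rewrite (@joint_integral_mixture _ _ _ _ _ _ g)//; last first.
  by move=> l l0; rewrite mulr_ge0 ?g0 ?pr0.
rewrite (@joint_integral_mixture _ _ _ _ _ _ (fun=> 1))//; last first.
  by move=> l l0; rewrite mul1r pr0.
under [X in (_ / X)%E]eq_integral do rewrite mul1r.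
rewrite -/pr -/mx.
have mprmx : measurable_fun (`]0, +oo[ : set R) (fun l => (pr l)%:E * mx l)%E.
  by apply: emeasurable_funM => //; exact/measurable_EFinP.
have mgprmx : measurable_fun (`]0, +oo[ : set R) (fun l => (g l * pr l)%:E * mx l)%E.
  by apply: emeasurable_funM => //; apply/measurable_EFinP; exact: measurable_funM.
have prmx0 l : 0 < l -> (0 <= (pr l)%:E * mx l)%E.
  by move=> l0; rewrite mule_ge0// lee_fin pr0.
have gprmx0 l : 0 < l -> (0 <= (g l * pr l)%:E * mx l)%E.
  by move=> l0; rewrite mule_ge0// lee_fin mulr_ge0 ?g0 ?pr0.
(* Wherever the shrinkage factor is at most [k], the numerator's integrand is at most [k] times the
   denominator's; the indicator only decreases it. *)
have gle l k : 0 < l -> shrinkage tau l <= k ->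
    ((g l * pr l)%:E * mx l <= k%:E * ((pr l)%:E * mx l))%E.
  move=> l0 lk; rewrite muleA -EFinM lee_wpmul2r// lee_fin ler_wpM2r ?pr0//.
  rewrite (le_trans _ lk)// /g indicE; case: (_ \in _); rewrite ?mulr1 ?mulr0//.
  by rewrite ltW// shrinkage_gt0.
have kle l : 0 < l -> shrinkage tau l <= 1.
  move=> l0; rewrite invf_le1; last by rewrite addr_gt0// mulr_gt0// exprn_gt0.
  by rewrite lerDl mulr_ge0 ?sqr_ge0// ltW.
apply: lee_div_le.
- by rewrite divr_ge0 ?(ltW x20)// addr_ge0// ltW.
- by apply: integral_ge0 => l /=; rewrite in_itv/= andbT; exact: gprmx0.
- by apply: integral_ge0 => l /=; rewrite in_itv/= andbT; exact: prmx0.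
have C0 : 0 <= (1 + c1 / c2) / x ^+ 2.
  by rewrite divr_ge0 ?(ltW x20)// addr_ge0// ltW.
have [x1|x1] := leP (x ^+ 2) 1.
  rewrite -ge0_integralZl_EFin//; last first.
    by move=> l /=; rewrite in_itv/= andbT; exact: prmx0.
  apply: ge0_le_integral => //.
  - by move=> l /=; rewrite in_itv/= andbT; exact: gprmx0.
  - exact: measurable_funeM.
  move=> l /=; rewrite in_itv/= andbT => l0; apply: gle => //.
  rewrite (le_trans (kle _ l0))// ler_pdivlMr// mul1r (le_trans x1)//.
  by rewrite lerDl ltW.
set B := x ^+ 2 / tau ^+ 2; set b := B `^ (- a - 1).
have B0 : 0 < B by rewrite divr_gt0// exprn_gt0.
have b0 : 0 < b by exact: powR_gt0.
pose d := c1 * b / `|x| ^+ 3.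
have d0 : 0 < d by rewrite !divr_gt0 ?mulr_gt0 ?exprn_gt0.
have ix0 : 0 <= (x ^+ 2)^-1 by rewrite invr_ge0 ltW.
(* Each summand dominates on one side of [B]. Beyond [B], [1 + l tau^2 > x^2]. Up to [B], the
   constant [d] bounds the part with shrinkage factor at most [u], and the indicator kills the
   rest. *)
have split_le l : 0 < l -> ((g l * pr l)%:E * mx l <=
    (x ^+ 2)^-1%:E * ((pr l)%:E * mx l) + d%:E * (\1_`]0, B] l)%:E)%E.
  move=> l0; have [lB|Bl] := leP l B; last first.
    apply: (@le_trans _ _ ((x ^+ 2)^-1%:E * ((pr l)%:E * mx l))%E); last first.
      by rewrite leeDl// mule_ge0// lee_fin ltW.
    apply: gle => //; rewrite lef_pV2 ?posrE//; last first.
      by rewrite addr_gt0// mulr_gt0// exprn_gt0.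
    by move: Bl; rewrite ltr_pdivrMr ?exprn_gt0//; lra.
  apply: (@le_trans _ _ (d%:E * (\1_`]0, B] l)%:E)%E); last first.
    by rewrite leeDr// mule_ge0 ?prmx0.
  have lin : l \in (`]0, B]%classic : set R) by rewrite inE/= in_itv/= l0.
  rewrite indicE lin mule1.
  rewrite /g indicE; have [ku|ku] := boolP (_ \in _); last first.
    by rewrite mulr0 mul0r mul0e lee_fin ltW.
  by move: ku; rewrite mulr1 inE/=; exact: c1P.
apply: (@le_trans _ _ (\int[lebesgue_measure]_(l in `]0%R, +oo[)
   ((x ^+ 2)^-1%:E * ((pr l)%:E * mx l) + d%:E * (\1_`]0, B] l)%:E))%E).
  apply: ge0_le_integral => //.
  - by move=> l /=; rewrite in_itv/= andbT; exact: gprmx0.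
  - apply: emeasurable_funD; apply: measurable_funeM => //.
    by apply/measurable_EFinP; apply: measurable_indic.
  by move=> l /=; rewrite in_itv/= andbT; exact: split_le.
have mind : measurable_fun (`]0, +oo[ : set R) (fun l : R => (\1_`]0, B] l)%:E : \bar R).
  by apply/measurable_EFinP; apply: measurable_indic.
rewrite ge0_integralD//; first last.
- exact: measurable_funeM.
- by move=> l _; rewrite mule_ge0// lee_fin ltW.
- exact: measurable_funeM.
- by move=> l /=; rewrite in_itv/= andbT => l0; rewrite mule_ge0 ?prmx0.
rewrite !ge0_integralZl_EFin ?(ltW d0)//; last first.
  by move=> l /=; rewrite in_itv/= andbT; exact: prmx0.
rewrite integral_indic//= setIidl; last first.
  by move=> l /=; rewrite !in_itv/= andbT => /andP[].
rewrite lebesgue_measure_itv/= lte_fin B0 oppr0 adde0.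
have := c2P tau x tau01 x1; rewrite -/B -/b -/pr.
set D := (\int[_]_(l in _) _)%E => DP.
have D0 : (0 <= D)%E.
  by apply: integral_ge0 => l /=; rewrite in_itv/= andbT; exact: prmx0.
have c12x : 0 <= c1 / c2 / x ^+ 2 by rewrite divr_ge0 ?(ltW x20) ?(ltW c12).
(* The first summand is [1 / x^2] times the marginal, and [d B] is exactly [(c1 / c2) / x^2] times
   the lower bound in [DP]. *)
rewrite mulrDl mul1r EFinD ge0_muleDl//.
apply: leeD => //.
apply: le_trans (lee_wpmul2l _ DP) => //.
rewrite -!EFinM lee_fin le_eqVlt; apply/orP; left; apply/eqP.
have -> : x ^+ 2 = `|x| ^+ 2 by rewrite real_normK ?num_real.
by rewrite /d; field; rewrite !gt_eqF.
Qed.
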